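(* Let $X$ be a topological space such that either $X$ is sequential and locally contractible, or $X$ is first-countable and locally path-connected. Then $X$ is path-inductive.
   Context: A path in a topological space $X$ is any continuous function $\gamma:[0,1]\to X$. A topological space $X$ is path-inductive if a subset $U\subset X$ is open if and only if for any path $\gamma:[0,1]\to X$ the preimage $\gamma^{-1}(U)$ is open in $[0,1]$. The terms sequential, locally contractible, first-countable and locally path-connected have their usual topological meanings.
   Formalization: ''Locally contractible'' is taken in the pointed sense: each neighbourhood U of x contains a neighbourhood V of x that contracts to x inside U by a homotopy keeping x fixed; with free contractions the sequential case fails. *)

(* Defs.v *)
(* MathComp-Analysis *)
From HB Require Import structures.
From mathcomp Require Import all_boot all_order all_algebra.
From mathcomp Require Import all_classical all_reals topology normedtype.

Set Implicit Arguments.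
Unset Strict Implicit.
Unset Printing Implicit Defensive.
Import Order.TTheory GRing.Theory Num.Theory.
Import numFieldNormedType.Exports.
Local Open Scope classical_set_scope.
Local Open Scope ring_scope.

(* A path [0,1] -> X is represented by a total function on R whose values off
   [0,1] are irrelevant. *)
Definition is_path (R : realType) (X : topologicalType) (g : R -> X) : Prop :=
  {within `[0, 1], continuous g}.

(* In [subspace `[0, 1]] the points off [0,1] are isolated, so openness there
   is openness in [0,1] of the trace on [0,1] (open_subspaceIT). *)
Definition path_inductive (R : realType) (X : topologicalType) : Prop :=
  forall U : set X,
    open U <->
    (forall g : R -> X, is_path g ->
       open (g @^-1` U : set (subspace (`[0, 1] : set R)))).

Definition sequential_space (X : topologicalType) : Prop :=
  forall A : set X,
    (forall (u : nat -> X) (x : X),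
       (forall n, A (u n)) -> u @ \oo --> x -> A x) ->
    closed A.

Definition first_countable (X : topologicalType) : Prop :=
  forall x : X, exists B : set (set X),
    [/\ countable B,
        (forall V, B V -> nbhs x V) &
        (forall U, nbhs x U -> exists2 V, B V & V `<=` U)].

Definition path_connected (R : realType) (X : topologicalType)
    (A : set X) : Prop :=
  forall x y, A x -> A y ->
    exists g : R -> X,
      [/\ is_path g, g 0 = x, g 1 = y & forall t : R, t \in `[0, 1] -> A (g t)].

Definition locally_path_connected (R : realType) (X : topologicalType) : Prop :=
  forall (x : X) (U : set X), nbhs x U ->
    exists V : set X, [/\ open V, V x, V `<=` U & path_connected R V].

(* [h] contracts [V] to the point [x] inside [U].  The contraction is pointed:
   it keeps [x] fixed. *)
Definition contraction_to (R : realType) (X : topologicalType)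
    (V U : set X) (x : X) (h : X * R -> X) : Prop :=
  [/\ {within V `*` `[0, 1], continuous h},
      (forall (v : X) (t : R), V v -> t \in `[0, 1] -> U (h (v, t))),
      (forall v, V v -> h (v, 0) = v),
      (forall v, V v -> h (v, 1) = x) &
      (forall t : R, t \in `[0, 1] -> h (x, t) = x)].

(* Local contractibility at [x]: arbitrarily small neighbourhoods of [x]
   contract to [x].  [V] need not contract inside itself, only inside the given
   [U]; spaces in which every point has a base of neighbourhoods with [x] as a
   strong deformation retract are a special case.  If the track of [x] were
   allowed to be a nontrivial loop, small neighbourhoods of [x] would not
   provide small paths to [x] along a whole sequence converging to [x]. *)
Definition locally_contractible (R : realType) (X : topologicalType) : Prop :=
  forall (x : X) (U : set X), nbhs x U ->
    exists V : set X, [/\ nbhs x V, V `<=` U &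
      exists h : X * R -> X, contraction_to V U x h].

(* Main.v *)
Require Import Defs.
From mathcomp Require Import all_boot all_order all_algebra.
From mathcomp Require Import all_classical all_reals topology normedtype.
From mathcomp Require Import sequences lra.

(** An open set has open preimages under paths simply because paths are
    continuous, so the content is the converse. Suppose [U] has open
    preimages under all paths but is not open.

    The idea is to detect this with a single path. Suppose there are a point
    [x] of [U] and paths [p n] from [x] to points outside [U] that shrink to
    [x], in the sense that every neighbourhood of [x] contains all but
    finitely many of them entirely ([small_paths]). Travel out along [p n]
    and back during a small time interval around [2 ^- n], these intervals
    being pairwise disjoint, and stay at [x] the rest of the time: the
    result is a path ([excursions_path]) that is at [x] at time [0] and at
    [p n 1] at time [2 ^- n]. The preimage of [U] is open and contains [0],
    so it contains [2 ^- n] for large [n], and [p n 1] lies in [U], a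
    contradiction ([path_open_small_paths]).

    Each of the two hypotheses on [X] provides such shrinking paths.
    - If [X] is sequential, points [u n] outside [U] converge to some [x] in
      [U]. A pointed contraction [h] of a neighbourhood of [x] gives the
      paths [h (u n, 1 - t)] from [x] to [u n]; they shrink to [x] because
      [h] keeps [x] fixed and [[0, 1]] is compact ([contraction_tube]).
    - If [X] is first-countable, take a point [x] of [U] of which [U] is not
      a neighbourhood, and a sequence [V n] of neighbourhoods of [x] that is
      eventually inside any given one. None of the
      path-connected neighbourhoods of [x] inside [V n] is contained in [U],
      so [x] can be joined inside [V n] to a point outside [U]. *)

Set Implicit Arguments.
Unset Strict Implicit.
Unset Printing Implicit Defensive.
Import Order.TTheory GRing.Theory Num.Theory.
Import numFieldNormedType.Exports.
Local Open Scope classical_set_scope.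
Local Open Scope ring_scope.

(** A tent with apex [1] at [2 ^- n], positive exactly between [2/3] and
    [4/3] of [2 ^- n]; the slope [3] makes successive tents adjacent but
    disjoint. *)
Definition spike (R : realType) (n : nat) (s : R) : R :=
  Num.max 0 (1 - 3 * `|2 ^+ n * s - 1|).

Lemma spike_itv (R : realType) n (s : R) : spike n s \in `[0, 1].
Proof.
rewrite in_itv /= /spike le_max lexx /= ge_max ler01 /=.
by rewrite lerBlDr lerDl mulr_ge0.
Qed.

Lemma spike0 (R : realType) n : spike n (0 : R) = 0.
Proof. by rewrite /spike mulr0 sub0r normrN1; apply/max_idPl; lra. Qed.

Lemma spike_top (R : realType) n : spike n (2^-1 ^+ n : R) = 1.
Proof.
rewrite /spike exprVn divff ?expf_neq0 ?pnatr_eq0 // subrr normr0 mulr0 subr0.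
by apply/max_idPr; lra.
Qed.

Lemma continuous_spike (R : realType) n : continuous (@spike R n).
Proof.
move=> s; apply: (@continuous_max R R (fun=> 0)
  (fun s => 1 - 3 * `|2 ^+ n * s - 1|)).
  exact: cvg_cst.
apply: cvgB; first exact: cvg_cst.
apply: cvgM; first exact: cvg_cst.
apply: cvg_norm; apply: cvgB; last exact: cvg_cst.
by apply: cvgM; [exact: cvg_cst|exact: cvg_id].
Qed.

(** At a common point of both supports, [2 ^+ m * s] and [2 ^+ n * s] would
    both lie in the open interval from [2/3] to [4/3], whose endpoints have
    ratio exactly [2]. *)
Lemma spike_disjoint (R : realType) m n (s : R) :
  0 < spike m s -> 0 < spike n s -> m = n.
Proof.
wlog: m n / (m <= n)%N => [wlg pm pn|].
  by case: (leqP m n) => [/wlg|/ltnW/wlg e]; [exact|exact/esym/e].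
rewrite leq_eqVlt => /orP[/eqP //|ltmn].
rewrite /spike !lt_max ltxx /= => pm pn.
have {}pm : `|2 ^+ m * s - 1| < 3^-1 by lra.
have {}pn : `|2 ^+ n * s - 1| < 3^-1 by lra.
move: pm pn; rewrite !ltr_norml => /andP[lo _] /andP[_ hi].
have : 2 * (2 ^+ m * s) <= 2 ^+ n * s.
  have lo' : 0 < 2 ^+ m * s by lra.
  have s0 : 0 < s by move: lo'; rewrite pmulr_rgt0 // exprn_gt0.
  by rewrite mulrA -exprS ler_pM2r // ler_eXn2l // ltr1n.
by move=> le2; exfalso; lra.
Qed.

Section path_inductive_spaces.
Variables (R : realType) (X : topologicalType).
Implicit Types (x : X) (p : nat -> R -> X) (U V W : set X).

Definition path_open U :=
  forall g : R -> X, is_path g ->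
    open (g @^-1` U : set (subspace (`[0, 1] : set R))).

Definition small_paths x p :=
  forall W, nbhs x W ->
    \forall n \near \oo, forall t : R, t \in `[0, 1] -> W (p n t).

(** The concatenation of the loops that run along [p n] and back, the [n]-th
    loop being run on the support of the [n]-th spike. *)
Definition excursions x p (s : R) : X :=
  if pselect (exists n, 0 < spike n s) is left h
  then p (projT1 (cid h)) (spike (projT1 (cid h)) s)
  else x.

Lemma excursionsE x p n s : 0 < spike n s -> excursions x p s = p n (spike n s).
Proof.
move=> ns; rewrite /excursions; case: pselect => [h|[]]; last by exists n.
by case: cid => m /= ms; rewrite (spike_disjoint ms ns).
Qed.

Lemma excursions_base x p s :
  (forall n, ~ 0 < spike n s) -> excursions x p s = x.
Proof.
move=> ns; rewrite /excursions; case: pselect => // h.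
by exfalso; case: h => n /ns.
Qed.

(** A path is only continuous within [[0, 1]]; precomposing with a map that
    has its values there removes the restriction. *)
Lemma continuous_path_comp (g : R -> X) (b : R -> R) :
  is_path g -> continuous b -> (forall s, b s \in `[0, 1]) ->
  continuous (g \o b).
Proof.
move=> /subspace_continuousP gc bc b01 s W /= Wgs.
have bW : \forall r \near s, b r \in `[0, 1] -> W (g (b r)).
  exact: bc s _ (gc _ (b01 s) _ Wgs).
by apply: filterS bW => r /=; apply; exact: b01.
Qed.

(** Where some spike is positive, it is so on a neighbourhood and only one
    loop matters there. Elsewhere the value is [x]; given a neighbourhood
    [W] of [x], all loops from some [N] on stay in [W], and each of the [N]
    first ones is in [W] near that time by continuity. The accumulation
    point [0] of the spikes and the ends of their supports are thus treated
    alike. *)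
Lemma excursions_path x p :
  (forall n, is_path (p n)) -> (forall n, p n 0 = x) -> small_paths x p ->
  is_path (excursions x p).
Proof.
move=> pp p0 ps; apply: continuous_subspaceT => s W /=.
have pc n : continuous (p n \o spike n).
  apply: continuous_path_comp => //; first exact: continuous_spike.
  exact: spike_itv.
have [[n ns]|/forallNP ns] := pselect (exists n, 0 < spike n s).
  rewrite (excursionsE _ _ ns) => Wn.
  have nb : \forall r \near s, 0 < spike n r.
    exact: (@continuous_spike R n s _ (lt_nbhsr ns)).
  by apply: filterS2 nb (pc n s W Wn) => r /= /(excursionsE x p) ->.
rewrite excursions_base // => Wx.
have spike_s n : spike n s = 0.
  apply/eqP; have := spike_itv n s; rewrite in_itv /= => /andP[le0 _].
  by rewrite eq_le le0 andbT leNgt; apply/negP/ns.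
have [N _ NW] := ps W Wx.
have early : \forall r \near s, forall n : 'I_N, W (p n (spike n r)).
  apply: (filter_forall (nbhs_filter s)) => n.
  have Wn : nbhs ((p n \o spike n) s) W by rewrite /= spike_s p0.
  exact: (pc n s W Wn).
apply: filterS early => r rW /=.
have [[n nr]|/forallNP nr] := pselect (exists n, 0 < spike n r); last first.
  by rewrite /= excursions_base //; exact: nbhs_singleton.
rewrite /= (excursionsE _ _ nr).
have [ltnN|leNn] := ltnP n N; first exact: (rW (Ordinal ltnN)).
by apply: NW => //; exact: spike_itv.
Qed.

(** Since [excursions x p] passes through [x] at time [0] and through [p n
    1] at time [2 ^- n], the preimage of [U] under it detects the endpoints. *)
Lemma path_open_small_paths x p U :
  path_open U -> U x ->
  (forall n, is_path (p n)) -> (forall n, p n 0 = x) -> small_paths x p ->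
  exists n, U (p n 1).
Proof.
move=> Uo Ux pp p0 ps.
have /open_subspaceP[V Vo VU] := Uo _ (excursions_path pp p0 ps).
have top_itv n : (2^-1 ^+ n : R) \in `[0, 1].
  have h0 : (0 : R) <= 2^-1 by lra.
  have h1 : (2^-1 : R) <= 1 by lra.
  by rewrite in_itv /= exprn_ge0 ?exprn_ile1.
have V0 : V 0.
  suff : (V `&` [set` `[0, 1]%R]) 0 by case.
  rewrite VU; split; last by rewrite /= in_itv /= lexx ler01.
  by rewrite /= excursions_base // => n; rewrite spike0 ltxx.
have half1 : `|2^-1 : R| < 1 by rewrite ger0_norm //; lra.
have [n _ nV] := cvg_expr half1 (open_nbhs_nbhs (conj Vo V0)).
exists n; have : (V `&` [set` `[0, 1]%R]) (2^-1 ^+ n).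
  by split; [exact: (nV n (leqnn n))|exact: top_itv].
by rewrite VU => -[/=]; rewrite (@excursionsE _ _ n) spike_top.
Qed.

Lemma first_countable_base x : first_countable X ->
  exists V : nat -> set X, (forall n, nbhs x (V n)) /\
    forall W, nbhs x W -> \forall n \near \oo, V n `<=` W.
Proof.
move=> /(_ x)[B [/countable_injP[f finj] Bx Bbase]].
(* [e] enumerates [B], with [setT] at the integers that [f] does not reach. *)
pose e k := xget setT [set V | B V /\ f V = k].
have ex k : nbhs x (e k).
  rewrite /e; case: xgetP => [V -> [BV _]|_]; [exact: Bx|exact: filterT].
have eV V : B V -> e (f V) = V.
  move=> BV; rewrite /e; case: xgetP => [V' -> [BV' fV]|]; last first.
    by move=> /(_ V) [].
  by apply: finj => //; exact: mem_set.
exists (fun n => [set y | forall k : 'I_n.+1, e k y]); split=> [n|W Wx].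
  by apply: (filter_forall (nbhs_filter x)) => k; exact: ex.
have [V BV VW] := Bbase _ Wx.
exists (f V) => // n /= fVn y /= ny; apply: VW.
have := ny (Ordinal (fVn : (f V < n.+1)%N)).
by rewrite /= eV.
Qed.

(** The tube lemma: for each [t] in [[0, 1]] the point [(x, t)], which [h]
    sends to [x], has a product neighbourhood whose part in the domain of
    [h] is mapped into [W], and by compactness one neighbourhood of [x]
    serves all [t]. *)
Lemma contraction_tube V U x (h : X * R -> X) :
  V x -> contraction_to V U x h ->
  forall W, nbhs x W ->
    \forall v \near x, V v -> forall t : R, t \in `[0, 1] -> W (h (v, t)).
Proof.
move=> Vx [/subspace_continuousP hc _ _ _ hx] W Wx.
have /compact_near_coveringP cov := @segment_compact R 0 1.
have /cov near_x : forall t : R, `[0, 1]%classic t ->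
    \forall t' \near t & v \near nbhs x, V v -> t' \in `[0, 1] -> W (h (v, t')).
  move=> t t01.
  have Wt : nbhs (h (x, t)) W by rewrite hx.
  have [[N M] /= [xN tM] NM] := hc (x, t) (conj Vx t01) W Wt.
  exists (M, N) => // -[t' v] [/= Mt' Nv] Vv t'01.
  exact: (NM (v, t')).
by apply: filterS near_x => v vW Vv t t01; exact: vW.
Qed.

Lemma contraction_path V U x (h : X * R -> X) v :
  V v -> contraction_to V U x h -> is_path (fun t => h (v, 1 - t)).
Proof.
move=> Vv [/subspace_continuousP hc _ _ _ _].
have flip (t : R) : t \in `[0, 1] -> 1 - t \in `[0, 1].
  by rewrite !in_itv /=; lra.
apply/subspace_continuousP => t t01 W /= Wt.
have [[N M] /= [vN tM] NM] := hc (v, 1 - t) (conj Vv (flip _ t01)) W Wt.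
have : (1 - r) @[r --> t] --> 1 - t.
  by apply: cvgB; [exact: cvg_cst|exact: cvg_id].
move=> /(_ _ tM); rewrite /= !nbhs_simpl /within /=; apply: filterS => r Mr r01.
by apply: (NM (v, 1 - r)); split => //=; [exact: nbhs_singleton|exact: flip].
Qed.

Lemma open_path_open U : open U -> path_open U.
Proof. by move=> Uo g /continuousP; apply. Qed.

Lemma sequential_path_inductive :
  sequential_space X -> locally_contractible R X -> path_inductive R X.
Proof.
move=> Xseq Xlc U; split=> [|Uo]; first exact: open_path_open.
rewrite -[U]setCK openC; apply: Xseq => u x nUu ux Ux.
have [V [xV _ [h hc]]] := Xlc x setT filterT.
have [_ _ h0 h1 _] := hc.
have [N _ NV] := ux V xV.
have Vx : V x by exact: nbhs_singleton.
(* Only the tail of [u] that lies in [V] can be contracted. *)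
pose v n := u (n + N)%N.
have Vv n : V (v n) by apply: NV; rewrite /= leq_addl.
have vx : v @ \oo --> x by apply: cvg_comp ux; exact: cvg_addnr.
have [n] : exists n, U (h (v n, 1 - 1)).
  apply: (@path_open_small_paths x (fun n t => h (v n, 1 - t))) => //.
  - by move=> n; exact: contraction_path hc.
  - by move=> n; rewrite subr0 h1.
  - move=> W Wx.
    have vW : \forall n \near \oo,
        V (v n) -> forall t : R, t \in `[0, 1] -> W (h (v n, t)).
      exact: vx _ (contraction_tube Vx hc Wx).
    apply: filterS vW => n /(_ (Vv n)) nW t; rewrite in_itv /= => t01.
    by apply: nW; rewrite in_itv /=; lra.
by rewrite subrr h0 //; exact: nUu.
Qed.

Lemma first_countable_path_inductive :
  first_countable X -> locally_path_connected R X -> path_inductive R X.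
Proof.
move=> Xfc Xlpc U; split=> [|Uo]; first exact: open_path_open.
rewrite openE => x Ux; apply: contrapT => nUx.
have [V [Vx Vbase]] := first_countable_base x Xfc.
have /choice[p pP] n : exists g : R -> X,
    [/\ is_path g, g 0 = x, ~ U (g 1) & forall t, t \in `[0, 1] -> V n (g t)].
  have [C [Co Cx CV Cpath]] := Xlpc x (V n) (Vx n).
  have [y Cy nUy] : exists2 y, C y & ~ U y.
    apply: contrapT => CU; apply: nUx.
    apply: filterS (open_nbhs_nbhs (conj Co Cx)) => y Cy.
    by apply: contrapT => nUy; apply: CU; exists y.
  have [g [gp g0 g1 gC]] := Cpath x y Cx Cy.
  by exists g; split => //; [rewrite g1|move=> t /gC /CV].
have [|||n] := @path_open_small_paths x p U Uo Ux.
- by move=> n; case: (pP n).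
- by move=> n; case: (pP n).
- move=> W /Vbase; apply: filterS => n VW t t01; apply: VW.
  by case: (pP n) => _ _ _; exact.
- by case: (pP n).
Qed.

End path_inductive_spaces.

Theorem proposition1 (R : realType) (X : topologicalType)
    (hX : (sequential_space X /\ locally_contractible R X) \/
          (first_countable X /\ locally_path_connected R X)) :
  path_inductive R X.
Proof.
case: hX => -[]; first exact: sequential_path_inductive.
exact: first_countable_path_inductive.
Qed.
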